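(* Let $X$ be a complex Banach space and let $T$ be a hypercyclic bounded linear operator on $X$. Let also $(f(n))$ be a sequence of real numbers such that for some $\delta>0$, $|f(n)-f(m)|>\delta$ for all $n\neq m$. Then for every $x\in HC(T)$ there exists a residual subset $A$ of $\mathbb R$ with full measure such that for every $\theta\in A$ the set $\{(T^n x,e^{2\pi i f(n)\theta});\ n\geq 1\}$ is dense in $X\times\mathbb T$.
   Context: $\mathbb T$ is the unit circle in $\mathbb C$. $HC(T)$ is the set of hypercyclic vectors for $T$, i.e. vectors $x\in X$ such that $\{T^n x;\ n\geq 0\}$ is dense in $X$; $T$ is hypercyclic if $HC(T)\neq\emptyset$. Residual means comeager (the complement is of first category); full measure means that the complement has Lebesgue measure zero. *)

(* Defs.v *)
From HB Require Import structures.
From mathcomp Require Import all_boot all_order all_algebra.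
From mathcomp Require Import all_classical all_reals all_analysis.
From mathcomp Require Export complex.

Set Implicit Arguments.
Unset Strict Implicit.
Unset Printing Implicit Defensive.

Import Order.TTheory GRing.Theory Num.Theory.
Import numFieldNormedType.Exports.

Local Open Scope classical_set_scope.
Local Open Scope ring_scope.
Local Open Scope complex_scope.

(* The norm of a normed module over R[i] takes its values in R[i]; such values
   are real, since x <= y in R[i] forces 'Im x = 'Im y. *)
Definition bounded_operator (R : realType) (X : normedModType R[i])
    (T : {linear X -> X}) : Prop :=
  exists M : R, forall x : X, `|T x| <= M%:C * `|x|.

Definition hypercyclic_vectors (R : realType) (X : normedModType R[i])
    (T : X -> X) : set X :=
  [set x | dense [set iter n T x | n in [set: nat]]].

Definition hypercyclic (R : realType) (X : normedModType R[i])
    (T : X -> X) : Prop :=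
  hypercyclic_vectors T !=set0.

Definition nowhere_dense (T : topologicalType) (A : set T) : Prop :=
  (closure A)° = set0.

Definition first_category (T : topologicalType) (A : set T) : Prop :=
  exists2 F : nat -> set T,
    (forall k, nowhere_dense (F k)) & A = \bigcup_k F k.

Definition residual (T : topologicalType) (A : set T) : Prop :=
  first_category (~` A).

(* The measure is defined on the Borel sets, so [negligible] provides the usual
   completion: the complement is contained in a Borel set of measure zero. *)
Definition full_measure (R : realType) (A : set R) : Prop :=
  (@lebesgue_measure R).-negligible (~` A).

(* [R[i]^o] is R[i] with the topology given by its modulus. As a type, the set
   [unit_circle R] carries the topology induced by [R[i]^o]. *)
Definition unit_circle (R : realType) : set R[i]^o :=
  [set z : R[i]^o | `|z| = 1].
Arguments unit_circle : clear implicits.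

Lemma expi2pi_subproof (R : realType) (t : R) :
  ((cos (2 * pi * t) +i* sin (2 * pi * t)) : R[i]^o) \in unit_circle R.
Proof. by apply/mem_set; rewrite /unit_circle/= normc_def/= cos2Dsin2 sqrtr1. Qed.

(* expi2pi t = e^{2 pi i t} *)
Definition expi2pi (R : realType) (t : R) : unit_circle R :=
  exist _ (cos (2 * pi * t) +i* sin (2 * pi * t)) (expi2pi_subproof t).

(* Main.v *)
Require Import Defs.
From mathcomp Require Import all_boot all_order all_algebra.
From mathcomp Require Import all_classical all_reals all_analysis.
From mathcomp Require Import measurable_realfun ring lra.
Import Order.TTheory GRing.Theory Num.Theory.
Import numFieldNormedType.Exports.
Local Open Scope classical_set_scope.
Local Open Scope ring_scope.

(** Fix a hypercyclic vector x. The balls around the iterates T^k x of radius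
1/(m+1) form a base of the topology of X, and the arcs of the circle with
rational centre q and radius 1/(j+1), measured in turns, form a base of the
circle. So it suffices to find, for each pair of basic sets, a set of theta
that is good for that pair and whose complement is both nowhere dense and
negligible: there are countably many pairs, and A is the intersection of these
good sets.

For one pair, the orbit enters the given ball for an infinite set N of times
(hypercyclic_visits_infinite): a nonempty open set has infinitely many points
unless X = 0. Separation of f makes |f n| unbounded on N
(separated_unbounded). The good set consists of the theta for which
e^{2 pi i f(n) theta} lies in the arc for some n in N; it is open (open_hits).
Its complement C is negligible by Lebesgue's density theorem
(negligible_hitsC): theta |-> f(n) theta has period 1/|f n| modulo 1, so within
distance 1/|f n| of any point there is a centre of an interval of length
proportional to 1/|f n| that misses C. As |f n| is unbounded, C has holes of a
fixed proportion at arbitrarily small scales around each of its points, so none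
of them is a density point (porous_negligible). Finally, a closed negligible
set has empty interior (nowhere_dense_closed_negligible), so smallness in
measure yields smallness in category. *)

(** * Porosity, measure and category *)

(** Almost every point of C is a density point, whereas a hole of radius c * r
inside [ball x r] bounds the density of C in that ball by 1 - c. *)
Lemma porous_negligible (R : realType) (C : set R) (c : R) :
  measurable C -> 0 < c ->
  (forall x, C x -> forall e, 0 < e -> exists r y,
    [/\ 0 < r < e, ball y (c * r) `<=` ball x r &
        ball y (c * r) `<=` ~` C]) ->
  (@lebesgue_measure R).-negligible C.
Proof.
move=> mC c0 porous; apply: negligibleS (lebesgue_density mC) => x Cx /=.
have -> : (\1_C x)%:E = 1%E :> \bar R by rewrite indicE mem_set.
move=> density.
have dense_scales : \forall r \near 0^'+,
    ((1 - c)%:E < lebesgue_measure (C `&` ball x r)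
                  / lebesgue_measure (ball x r))%E.
  apply: (density [set z | ((1 - c)%:E < z)%E]); apply: open_ereal_gt'.
  by rewrite lte_fin gtrBl.
have [e /= e0 He] := dense_scales.
have [r [y [/andP[r0 re] yx yC]]] := porous x Cx e e0.
have := He r; rewrite /= sub0r normrN gtr0_norm// => /(_ re r0).
apply/negP; rewrite -leNgt (lebesgue_measure_ball _ (ltW r0)).
have r2 : 0 < r *+ 2 by rewrite pmulrn_lgt0.
rewrite inver (gt_eqF r2) lee_pdivrMr// -EFinM.
rewrite [leRHS](_ : _ = (r *+ 2)%:E - ((c * r) *+ 2)%:E)%E; last first.
  by rewrite -EFinB; congr (_%:E); rewrite mulrBl mul1r mulrnAr.
rewrite leeBrDr// -(lebesgue_measure_ball x (ltW r0)).
rewrite -(lebesgue_measure_ball y (ltW (mulr_gt0 c0 r0))) -measureU.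
- apply: le_measure; rewrite ?inE.
  + apply: measurableU; last exact: measurable_ball.
    by apply: measurableI => //; exact: measurable_ball.
  + exact: measurable_ball.
  + by rewrite subUset; split => //; exact: subIsetr.
- by apply: measurableI => //; exact: measurable_ball.
- exact: measurable_ball.
- by apply/seteqP; split => // z [[Cz _] /yC].
Qed.

(** Every ball has positive measure, so C contains none. *)
Lemma nowhere_dense_closed_negligible (R : realType) (C : set R) :
  closed C -> (@lebesgue_measure R).-negligible C -> nowhere_dense C.
Proof.
move=> clC [B [mB B0 CB]]; rewrite /nowhere_dense -(closure_id C).1//.
apply/seteqP; split => // x /nbhs_ballP[e /= e0 eC].
have : (lebesgue_measure (ball x e) <= lebesgue_measure B)%E.
  rewrite le_measure ?inE//; first exact: measurable_ball.
  exact: subset_trans CB.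
by rewrite B0 (lebesgue_measure_ball _ (ltW e0)) lee_fin leNgt pmulrn_lgt0 ?e0.
Qed.

(** If |f| were bounded by M on N, then cutting [-M, M] into finitely many cells
of length d would inject N into the set of cells. *)
Lemma separated_unbounded (R : realType) (f : nat -> R) (N : set nat) (d : R) :
  infinite_set N -> 0 < d ->
  {in N &, forall n m, n <> m -> d < `|f n - f m|} ->
  forall M, exists2 n, N n & M < `|f n|.
Proof.
move=> Ninf d0 fsep M; apply: contrapT => nfar; apply: Ninf.
have fM n : N n -> `|f n| <= M.
  by move=> Nn; rewrite leNgt; apply/negP => Mf; apply: nfar; exists n.
pose cell n := Num.trunc ((f n + M) / d).
have cell_ge0 n : N n -> 0 <= (f n + M) / d.
  move=> /fM; rewrite ler_norml => /andP[? _].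
  by rewrite divr_ge0 ?(ltW d0)//; lra.
have celli : {in N &, injective cell}.
  move=> n m /set_mem Nn /set_mem Nm nm; apply: contrapT => neq.
  have := fsep n m (mem_set Nn) (mem_set Nm) neq; apply/negP; rewrite -leNgt.
  have := truncn_itv (cell_ge0 n Nn); have := truncn_itv (cell_ge0 m Nm).
  rewrite -/(cell n) -/(cell m) nm !ler_pdivlMr// !ltr_pdivrMr//.
  rewrite -natr1 mulrDl mul1r ler_norml => /andP[? ?] /andP[? ?].
  by apply/andP; split; lra.
have := inj_card_eq celli; rewrite card_eq_le => /andP[_ leN].
apply: card_le_finite leN _.
apply: (@sub_finite_set _ _ `I_(Num.trunc ((M + M) / d)).+1) => //.
move=> _ [n Nn <-] /=; rewrite ltnS le_truncn// ler_pM2r ?invr_gt0//.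
by rewrite lerD2r; have := fM n Nn; rewrite ler_norml => /andP[].
Qed.

(** * Phases hitting an arc *)

(** The integer k makes the condition one on the fractional part, that is, on
the point e^{2 pi i f(n) theta} of the circle. *)
Definition hits (R : realType) (f : nat -> R) (N : set nat) (s e : R) : set R :=
  [set theta | exists2 n, N n &
    exists k : int, `|f n * theta + k%:~R - s| < e].

Lemma open_hits (R : realType) (f : nat -> R) (N : set nat) (s e : R) :
  open (hits R f N s e).
Proof.
rewrite (_ : hits R f N s e = \bigcup_(n in N) \bigcup_(k in [set: int])
    ((fun theta => f n * theta + k%:~R - s) @^-1` ball 0 e)); last first.
  apply/seteqP; split => theta [n Nn].
    by move=> [k hk]; exists n => //; exists k => //=; rewrite /ball/= sub0r normrN.
  by move=> [k _]; rewrite /= /ball/= sub0r normrN; exists n => //; exists k.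
apply: bigcup_open => n _; apply: bigcup_open => k _.
apply: open_comp; last exact: ball_open.
move=> theta _; apply: cvgB; last exact: cvg_cst.
by apply: cvgD; [apply: cvgM; [exact: cvg_cst|exact: cvg_id]|exact: cvg_cst].
Qed.

(** At the scale (1 + e) / |f n| around any point x there is a hole of radius
e / |f n|, so the complement is porous with constant e / (1 + e). *)
Lemma negligible_hitsC (R : realType) (f : nat -> R) (N : set nat) (s e : R) :
  (forall M, exists2 n, N n & M < `|f n|) -> 0 < e ->
  (@lebesgue_measure R).-negligible (~` hits R f N s e).
Proof.
move=> funb e0.
have He : 0 < 1 + e by rewrite addr_gt0.
apply: (@porous_negligible _ _ (e / (1 + e))); rewrite ?divr_gt0//.
  by apply: closed_measurable; apply: open_closedC; exact: open_hits.
move=> x _ eta eta0.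
have [n Nn] := funb ((1 + e) / eta); rewrite ltr_pdivrMr// => hn.
have fn0 : 0 < `|f n|.
  by rewrite -(pmulr_lgt0 _ eta0); exact: lt_trans hn.
have fn0' : f n != 0 by rewrite -normr_gt0.
(* y is the solution of f n * y = s modulo 1 for which f n * y is closest to
   f n * x from above, whence `|x - y| < 1 / `|f n|. *)
pose k := Num.floor (s - f n * x).
have /andP[k1 k2] := floor_itv (s - f n * x).
rewrite -/k in k1 k2.
pose y := (s - k%:~R) / f n.
have fy : f n * y = s - k%:~R by rewrite mulrC divfK.
have cr : e / (1 + e) * ((1 + e) / `|f n|) = e / `|f n|.
  by rewrite mulrA divfK ?gt_eqF.
exists ((1 + e) / `|f n|), y; rewrite cr; split.
- by rewrite divr_gt0//= ltr_pdivrMr// mulrC.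
- move=> z; rewrite /ball/= !ltr_pdivlMr// => yz.
  have -> : x - z = (x - y) + (y - z) by rewrite addrA subrK.
  rewrite (le_lt_trans (ler_wpM2r _ (ler_normD _ _)))// mulrDl ler_ltD//.
  rewrite -normrM mulrC mulrBr fy ler_norml.
  rewrite intrD in k2; apply/andP; split; lra.
- move=> z; rewrite /ball/= ltr_pdivlMr// => yz; apply; exists n => //.
  exists k; rewrite (_ : _ - s = - (f n * (y - z))); last by rewrite mulrBr fy; ring.
  by rewrite normrN normrM mulrC.
Qed.

(** * The circle as the line modulo 1 *)

Lemma expi2piDz (R : realType) (t : R) (k : int) :
  expi2pi (t + k%:~R) = expi2pi t.
Proof.
have nat_shift (u : R) n : expi2pi (u + n%:R) = expi2pi u.
  have pin : 2 * pi * (u + n%:R) = 2 * pi * u + (pi *+ 2) *+ n :> R.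
    by rewrite mulrDr; congr +%R; rewrite -[in RHS]mulr_natl -[in RHS]mulr_natl; ring.
  apply/val_inj => /=.
  by rewrite pin (periodicn (@cosD2pi R)) (periodicn (@sinD2pi R)).
case: k => n; first exact: nat_shift.
by rewrite -[in RHS](subrK n.+1%:R t) nat_shift NegzE.
Qed.

Lemma expi2pi_surjective (R : realType) (z : unit_circle R) :
  exists t, expi2pi t = z.
Proof.
case: z => -[a b] zP; have := set_mem zP.
rewrite /unit_circle/= normc_def/= => -[ab1].
have ab : a ^+ 2 + b ^+ 2 = 1.
  have := sqr_sqrtr (addr_ge0 (sqr_ge0 a) (sqr_ge0 b)).
  by rewrite ab1 expr1n.
have a1 : -1 <= a <= 1.
  by rewrite -ler_norml -(@ler_sqr R) ?nnegrE// expr1n real_normK ?num_real//;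
     have := sqr_ge0 b; lra.
have sinE : Num.sqrt (1 - a ^+ 2) = `|b|.
  by rewrite -ab addrC addKr sqrtr_sqr.
have [b0|b0] := leP 0 b.
  exists (acos a / (2 * pi)); apply/val_inj => /=.
  rewrite [_ * (_ / _)]mulrC divfK ?mulf_neq0 ?gt_eqF ?pi_gt0//.
  by rewrite acosK// sin_acos// sinE ger0_norm.
exists (- acos a / (2 * pi)); apply/val_inj => /=.
rewrite [_ * (_ / _)]mulrC divfK ?mulf_neq0 ?gt_eqF ?pi_gt0//.
by rewrite cosN sinN acosK// sin_acos// sinE ltr0_norm// opprK.
Qed.

Lemma norm_complex_le (R : realType) (a b : R) :
  (`|(a +i* b)%C| <= (`|a| + `|b|)%:C%C :> R[i]).
Proof.
rewrite normc_def/= lecR -[leRHS]ger0_norm ?addr_ge0// -sqrtr_sqr ler_wsqrtr//.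
rewrite sqrrD !real_normK ?num_real// lerD2r lerDl.
by rewrite mulrn_wge0// mulr_ge0.
Qed.

(** Pulling neighbourhoods in the circle back to intervals of the real line
reduces the statement to phases modulo 1. *)
Lemma nbhs_expi2pi (R : realType) (W : set (unit_circle R)) (s : R) :
  nbhs (expi2pi s) W ->
  exists2 e : R, 0 < e & ball s e `<=` @expi2pi R @^-1` W.
Proof.
move=> nW.
have lin_cvg (t : R) : 2 * pi * u @[u --> t] --> 2 * pi * t.
  by apply: cvgM; [exact: cvg_cst|exact: cvg_id].
have : continuous (@expi2pi R : R -> unit_circle R).
  apply: continuous_comp_initial => t.
  apply/cvgrPdist_lt => -[eps eps']; rewrite ltcE/= => /andP[/eqP-> eps0].
  have eps20 : 0 < eps / 2 by rewrite divr_gt0.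
  have cosc : cos (2 * pi * u) @[u --> t] --> cos (2 * pi * t).
    exact: (continuous_cvg _ (@continuous_cos R _) (lin_cvg t)).
  have sinc : sin (2 * pi * u) @[u --> t] --> sin (2 * pi * t).
    exact: (continuous_cvg _ (@continuous_sin R _) (lin_cvg t)).
  near=> u => /=.
  apply: le_lt_trans (norm_complex_le _ _ _) _.
  rewrite (_ : Complex eps 0 = eps%:C%C)// ltcR (splitr eps) ltrD//; near: u.
    by move/cvgrPdist_lt : cosc; exact.
  by move/cvgrPdist_lt : sinc; exact.
move=> /(_ s) /(_ W nW) /nbhs_ballP[e /= e0 ?]; by exists e.
Unshelve. all: by end_near. Qed.

(** * Visits of a hypercyclic orbit *)

(** Moving from a point of U in the direction of x by smaller and smaller steps
gives infinitely many points of U. *)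
Lemma infinite_open_set (K : numFieldType) (X : normedModType K) (x : X)
    (U : set X) :
  x != 0 -> open U -> U !=set0 -> infinite_set U.
Proof.
move=> x0 oU [y Uy] finU; apply: infinite_nat.
have /nbhs_ballP[e /= e0 eU] : nbhs y U by exact: open_nbhs_nbhs.
pose c := e / (`|x| *+ 2).
have x2 : 0 < `|x| *+ 2 by rewrite pmulrn_lgt0// normr_gt0.
have c0 : 0 < c by rewrite divr_gt0.
pose p (n : nat) := y + (c / n.+1%:R) *: x.
rewrite (_ : [set: nat] = p @^-1` U); last first.
  apply/seteqP; split => // n _; apply: eU; rewrite -ball_normE/= /p.
  rewrite opprD addrA subrr sub0r normrN normrZ ger0_norm ?divr_ge0 ?ltW//.
  rewrite mulrAC ltr_pdivrMr// /c.
have -> : e / (`|x| *+ 2) * `|x| = e / 2.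
    by rewrite -mulr_natr; field; rewrite normr_eq0.
  rewrite ltr_pdivrMr// -mulrA ltr_pMr// -natrM ltr1n.
  by rewrite muln2 doubleS.
apply: finite_preimage finU => n m _ _ /addrI /eqP.
rewrite -subr_eq0 -scalerBl scaler_eq0 (negbTE x0) orbF subr_eq0.
move=> /eqP /(mulfI (lt0r_neq0 c0)) /invr_inj /eqP.
by rewrite eqr_nat eqSS => /eqP.
Qed.

(** For x = 0 the whole orbit is 0, hence X = 0 and every time is a visit.
Otherwise, removing from U the finitely many orbit points visited leaves a
nonempty open set, which the dense orbit must meet again. *)
Lemma hypercyclic_visits_infinite (R : realType) (X : normedModType R[i])
    (T : {linear X -> X}) (x : X) (U : set X) :
  hypercyclic_vectors T x -> open U -> U !=set0 ->
  infinite_set [set n | (1 <= n)%N /\ U (iter n T x)].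
Proof.
move=> hx oU U0.
have [x0|x0] := eqVneq x 0.
  have orbit0 n : iter n T x = 0.
    by elim: n => //= n ->; rewrite linear0.
  have [z [Uz [n _ nz]]] := hx U U0 oU.
  have {}Uz : U 0 by rewrite -(orbit0 n) nz.
  move=> finN; apply: infinite_nat.
  rewrite (_ : [set: nat] = [set 0%N] `|` [set n | (1 <= n)%N /\ U (iter n T x)]).
    by rewrite finite_setU.
  by apply/seteqP; split => // -[|k] _; [left|right; split => //=; rewrite -iterS orbit0].
move=> finN.
(* Time 0 is put among the removed points so that the new visit has n >= 1. *)
pose F := (fun n => iter n T x) @` ([set n | (1 <= n)%N /\ U (iter n T x)] `|` [set 0%N]).
have finF : finite_set F by apply: finite_image; rewrite finite_setU.
have clF : closed F.
  by apply: (accessible_finite_set_closed.1 _ _ finF); apply: hausdorff_accessible; exact: norm_hausdorff.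
have oUF : open (U `\` F) by apply: openI => //; exact: closed_openC.
have [|z [[Uz nFz] [n _ nz]]] := hx (U `\` F) _ oUF.
  apply/set0P/negP => /eqP UF.
  apply: (infinite_open_set _ _ _ _ x0 oU U0).
  by apply: sub_finite_set finF; rewrite -setD_eq0.
apply: nFz; exists n => //; case: n nz => [|n] nz; first by right.
by left; split => //; rewrite nz.
Qed.

(** * Density of the joint orbit *)

Theorem proposition5p2 (R : realType) (X : completeNormedModType R[i])
    (T : {linear X -> X}) (Tbounded : bounded_operator T)
    (Thyp : hypercyclic T) (f : nat -> R)
    (fsep : exists2 delta : R, 0 < delta &
      forall n m : nat, (1 <= n)%N -> (1 <= m)%N -> n <> m ->
        delta < `|f n - f m|) :
  forall x : X, hypercyclic_vectors T x ->
    exists A : set R,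
      [/\ residual A, full_measure A &
        forall theta : R, A theta ->
          dense [set (iter n T x, expi2pi (f n * theta))
                | n in [set n : nat | (1 <= n)%N]]].
Proof.
move=> x hx; have [d d0 dsep] := fsep.
have small_inv (e : R) : 0 < e -> exists j, (j.+1%:R^-1 : R) *+ 2 < e.
  move=> e0; have e20 : 0 < e / 2 by rewrite divr_gt0.
  have [j _ /(_ j (leqnn j))] := near_infty_natSinv_lt (PosNum e20).
  by rewrite /= ltr_pdivlMr// mulr_natr => ?; exists j.
pose visits k m : set nat :=
  [set n | (1 <= n)%N /\ ball (iter k T x) (m.+1%:R^-1 : R)%:C%C (iter n T x)].
pose G (p : nat * nat * (rat * nat)) :=
  hits R f (visits p.1.1 p.1.2) (ratr p.2.1) p.2.2.+1%:R^-1.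
have visits_unbounded k m M : exists2 n, visits k m n & M < `|f n|.
  apply: (@separated_unbounded _ f _ d) => //; last first.
    by move=> n1 n2 /set_mem[? _] /set_mem[? _]; exact: dsep.
  have m0 : 0 < (m.+1%:R^-1 : R)%:C%C :> R[i] by rewrite ltcR.
  apply: hypercyclic_visits_infinite => //.
    exact: ball_open.
  by exists (iter k T x); exact: ballxx.
have negG p : (@lebesgue_measure R).-negligible (~` G p).
  by apply: negligible_hitsC => //; exact: visits_unbounded.
have nwdG p : nowhere_dense (~` G p).
  apply: nowhere_dense_closed_negligible => //.
  by apply: open_closedC; exact: open_hits.
(* The family is indexed by pairs of basic sets; an encoding of these by
   natural numbers turns it into a sequence, filled up with empty sets. *)
pose F i := oapp (fun p => ~` G p) set0 (unpickle i).
have FE : ~` (\bigcap_p G p) = \bigcup_i F i.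
  rewrite setC_bigcap; apply/seteqP; split => [t [p _ Gt]|t [i _]].
    by exists (pickle p) => //; rewrite /F pickleK.
  by rewrite /F; case: unpickle => //= p Gt; exists p.
exists (\bigcap_p G p); split.
- exists F => // i; rewrite /F; case: unpickle => //=.
  by rewrite /nowhere_dense closure0 interior0.
- rewrite /full_measure FE; apply: negligible_bigcup => i.
  by rewrite /F; case: unpickle => //=; exact: negligible_set0.
move=> theta Gtheta O [[u z] Ouz] oO.
have [[U W]/= [nU nW] UWO] : nbhs (u, z) O by exact: open_nbhs_nbhs.
have [eps /= eps0 epsU] : nbhs_ball u U by exact/nbhs_ballP.
have [s sz] := expi2pi_surjective R z.
have [e e0 eW] : exists2 e : R, 0 < e & ball s e `<=` @expi2pi R @^-1` W.
  by apply: nbhs_expi2pi; rewrite sz.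
(* Half of the radius is kept for the triangle inequality: the basic ball has
   to contain u and stay within U. The same is done for the arc. *)
have [m mU] : exists m, (m.+1%:R^-1 : R)%:C%C *+ 2 < eps.
  move: eps eps0 {epsU} => [a b]; rewrite ltcE/= => /andP[/eqP-> a0].
  have [m am] := small_inv a a0.
  by exists m; rewrite -rmorphMn/= (_ : Complex a 0 = a%:C%C)// ltcR.
have [k ku] : exists k, ball (iter k T x) (m.+1%:R^-1 : R)%:C%C u.
  have m0 : 0 < (m.+1%:R^-1 : R)%:C%C :> R[i] by rewrite ltcR.
  have [||v [uk [k _ kv]]] := hx (ball u (m.+1%:R^-1 : R)%:C%C).
  - by exists u; exact: ballxx.
  - exact: ball_open.
  by exists k; apply: ball_sym; rewrite kv.
have [j je] := small_inv e e0.
have [q qs] : exists q, ball s j.+1%:R^-1 (ratr q : R).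
  have : 0 < j.+1%:R^-1 :> R by [].
  move: (j.+1%:R^-1 : R) => r r0.
  have [q] : exists q, ratr q \in `]s - r, s + r[ by apply: rat_in_itvoo; lra.
  rewrite in_itv/= => /andP[? ?]; exists q.
  by rewrite /ball/= ltr_norml; apply/andP; split; lra.
have [n [n1 nu] [l lq]] := Gtheta (k, m, (q, j)) I.
exists (iter n T x, expi2pi (f n * theta)); split; last by exists n.
apply: UWO; split => /=.
  apply: epsU; apply: le_ball (ltW mU) _ _; rewrite mulr2n.
  exact: ball_triangle (ball_sym ku) nu.
rewrite -(expi2piDz _ _ l); apply: eW; apply: le_ball (ltW je) _ _.
rewrite mulr2n; apply: ball_triangle qs _.
by rewrite /ball/= distrC.
Qed.
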